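(* Let $\{D_n\}_{n\ge 1}$ be an infinite family of GCD domains such that $D_n\subseteq D_{n+1}$ (as a subring) for every $n$, and let $D=\bigcup_{n=1}^{\infty}D_n$ be their directed union. Then $D$ is a Bezout Intersection domain (BID).
   Context: An integral domain $D$ is a GCD domain if for all $a,b\in D$ the ideal $aD\cap bD$ is principal. An integral domain $D$ is a Bezout Intersection domain (BID) if for any finite collection of elements $a_1,\ldots,a_s\in D$, the ideal $I=a_1D\cap a_2D\cap\cdots\cap a_sD$ is either principal or not finitely generated. *)

(* Defs.v *)
From mathcomp Require Import all_boot all_algebra.
From mathcomp Require Import classical_sets.

Set Implicit Arguments.
Unset Strict Implicit.
Unset Printing Implicit Defensive.

Import GRing.Theory.
Local Open Scope classical_set_scope.
Local Open Scope ring_scope.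

(* Integral domains are taken as commutative nonzero rings satisfying
   [GRing.integral_domain_axiom], rather than as [idomainType]s, which also
   carry a boolean test for invertibility. *)

Section Ideals.
Variable R : comNzRingType.

Definition multiples (a : R) : set R := [set a * x | x in [set: R]].

Definition principal (I : set R) : Prop := exists c : R, I = multiples c.

Definition finitely_generated (I : set R) : Prop :=
  exists (m : nat) (g : 'I_m -> R),
    I = [set x | exists c : 'I_m -> R, x = \sum_(i < m) c i * g i].

End Ideals.

Definition gcd_domain (R : comNzRingType) : Prop :=
  GRing.integral_domain_axiom R /\
  forall a b : R, principal (multiples a `&` multiples b).

Definition bezout_intersection_domain (R : comNzRingType) : Prop :=
  GRing.integral_domain_axiom R /\
  forall (s : nat) (a : 'I_s -> R),
    let I := \bigcap_(i in [set: 'I_s]) multiples (a i) in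
    principal I \/ ~ finitely_generated I.

(* Main.v *)
Require Import Defs.
From mathcomp Require Import all_boot all_algebra.
From mathcomp Require Import boolp classical_sets.

(** If the intersection [I] of the ideals [a_i D] is generated by [g_1, ..., g_m],
    then some [D_n] contains every [a_i], every [g_j] and every quotient
    [g_j / a_i]. In the GCD domain [D_n] the intersection of the [a_i D_n] is
    generated by a single [c]. Then [c] lies in [I], and each [g_j] is a multiple
    of [c], so [I = c D]. *)

Set Implicit Arguments.
Unset Strict Implicit.
Unset Printing Implicit Defensive.

Import GRing.Theory.
Local Open Scope classical_set_scope.
Local Open Scope ring_scope.

Lemma multiplesP (R : comNzRingType) (a x : R) :
  multiples a x <-> exists y, x = a * y.
Proof.
split=> [[y _ <-]|[y ->]]; first by exists y.
by exists y.
Qed.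

(** Induction on [s]: the ideals after the first intersect in some [c R], and the GCD property then
    applies to [a ord0] and [c]. *)
Lemma gcd_domain_bigcap_principal (R : comNzRingType) (s : nat) (a : 'I_s -> R) :
  gcd_domain R -> principal (\bigcap_(i in [set: 'I_s]) multiples (a i)).
Proof.
move=> [_ gcdR]; elim: s a => [|s IHs] a.
  (* The empty intersection is the whole ring, the ideal of [1]. *)
  exists 1; apply/seteqP; split=> x _; last by case.
  by apply/multiplesP; exists x; rewrite mul1r.
have [c Ic] := IHs (fun i => a (lift ord0 i)).
have [d cd] := gcdR (a ord0) c.
exists d; rewrite -cd -Ic; apply/seteqP; split=> [x ax|x [ax0 ax] i _].
  by split=> [|i _]; apply: ax.
by case: (unliftP ord0 i) => [j|] ->; [apply: ax | ].
Qed.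

(** The maximum of finitely many individual bounds works for all indices; this places finite
    families of elements in a single [D_ n]. *)
Lemma ord_uniform_bound (s : nat) (Q : 'I_s -> nat -> Prop) :
  (forall i m n, (m <= n)%N -> Q i m -> Q i n) ->
  (forall i, exists n, Q i n) -> exists n, forall i, Q i n.
Proof.
move=> Qmono /fin_all_exists[f Qf]; exists (\max_i f i)%N => i.
by apply: Qmono (Qf i); apply: leq_bigmax.
Qed.

Section DirectedUnion.
Variables (D : comNzRingType) (P : nat -> pred D).
Variable D_ : forall n, subComNzRingType (P n).
Hypothesis D_gcd : forall n, gcd_domain (D_ n).
Hypothesis D_mono : forall n, {subset P n <= P n.+1}.
Hypothesis D_union : forall x : D, exists n, x \in P n.

Lemma chain_subset m n : (m <= n)%N -> {subset P m <= P n}.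
Proof.
by move=> /subnK <-; elim: (n - m)%N => // k IHk x /IHk; apply: D_mono.
Qed.

Lemma chain_lift n (x : D) : x \in P n -> exists u : D_ n, val u = x.
Proof. by move=> Px; exists (Sub x Px); rewrite SubK. Qed.

Lemma chain_family (s : nat) (x : 'I_s -> D) : exists n, forall i, x i \in P n.
Proof.
apply: (@ord_uniform_bound s (fun i n => x i \in P n)) => // i m n le_mn.
exact: chain_subset.
Qed.

(** Both factors lie in a common [D_ n], and their product already vanishes there because [val] is
    injective. *)
Lemma directed_union_integral : GRing.integral_domain_axiom D.
Proof.
move=> x y xy0.
have [k Pk] := D_union x; have [l Pl] := D_union y.
have [u uE] := chain_lift (chain_subset (leq_maxl k l) Pk).
have [v vE] := chain_lift (chain_subset (leq_maxr k l) Pl).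
have uv0 : u * v = 0 by apply: val_inj; rewrite rmorphM rmorph0 /= uE vE.
rewrite -uE -vE; have [/(_ _ _ uv0) /orP[] /eqP -> _] := D_gcd (maxn k l).
  by rewrite rmorph0 eqxx.
by rewrite rmorph0 eqxx orbT.
Qed.

Lemma directed_union_fg_principal (s : nat) (a : 'I_s -> D) :
  let I := \bigcap_(i in [set: 'I_s]) multiples (a i) in
  finitely_generated I -> principal I.
Proof.
move=> I [m [g Ig]].
have g_in j : I (g j).
  (* Kronecker delta coefficients single out [g j]. *)
  rewrite Ig; exists (fun k => (k == j)%:R).
  rewrite (bigD1 j) //= eqxx mul1r big1 ?addr0 // => k /negPf ->.
  by rewrite mul0r.
have /fin_all_exists[q qE] j : exists q : 'I_s -> D, forall i, g j = a i * q i.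
  apply: (@fin_all_exists _ (fun=> D) (fun i y => g j = a i * y)) => i.
  exact/multiplesP/g_in.
have [na Pa] := chain_family a; have [ng Pg] := chain_family g.
(* The quotients form a doubly indexed family: bound over [i] for each [j], then over [j]. *)
have [nq Pq] : exists n, forall j i, q j i \in P n.
  apply: (@ord_uniform_bound m (fun j n => forall i, q j i \in P n)).
    by move=> j k l le_kl Pk i; apply: chain_subset (Pk i).
  by move=> j; apply: chain_family.
pose n := maxn na (maxn ng nq).
have /fin_all_exists[b bE] i : exists u : D_ n, val u = a i.
  by apply: chain_lift; apply: chain_subset (Pa i); apply: leq_maxl.
have [c Jc] := gcd_domain_bigcap_principal b (D_gcd n).
have Ic : I (val c).
  move=> i _; have : multiples c c by apply/multiplesP; exists 1; rewrite mulr1.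
  rewrite -Jc => /(_ i Logic.I) /multiplesP[u cE]; apply/multiplesP.
  by exists (val u); rewrite cE rmorphM /= bE.
have /fin_all_exists[z zE] j : exists z, g j = val c * z.
  have [h hE] : exists u : D_ n, val u = g j.
    apply: chain_lift; apply: chain_subset (Pg j).
    by rewrite !leq_max leqnn orbT.
  (* Divisibility in [D] need not descend to [D_ n]; here it does because [n] was chosen so that the
     quotients [q j i] lie in [D_ n] too. *)
  have : multiples c h.
    rewrite -Jc => i _; apply/multiplesP.
    have [u uE] : exists u : D_ n, val u = q j i.
      apply: chain_lift; apply: chain_subset (Pq j i).
      by rewrite !leq_max leqnn !orbT.
    by exists u; apply: val_inj; rewrite rmorphM /= bE uE hE.
  by move=> /multiplesP[u hcu]; exists (val u); rewrite -hE hcu rmorphM.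
(* One inclusion factors [val c] out of a combination of the [g j]; the other holds since each ideal
   [multiples (a i)] absorbs multiplication. *)
exists (val c); apply/seteqP; split=> x.
  rewrite Ig => -[e ->]; apply/multiplesP; exists (\sum_j e j * z j).
  by rewrite mulr_sumr; apply: eq_bigr => j _; rewrite zE mulrCA.
move=> /multiplesP[y ->] i _; apply/multiplesP.
by have /multiplesP[t ->] := Ic i Logic.I; exists (t * y); rewrite mulrA.
Qed.

End DirectedUnion.

Theorem theorem2p2
    (D : comNzRingType) (P : nat -> pred D)
    (D_ : forall n : nat, subComNzRingType (P n))
    (D_gcd : forall n : nat, gcd_domain (D_ n))
    (D_mono : forall n : nat, {subset P n <= P n.+1})
    (D_union : forall x : D, exists n : nat, x \in P n) :
  bezout_intersection_domain D.
Proof.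
split; first exact: (directed_union_integral D_gcd D_mono D_union).
move=> s a I.
have [Ifg|] := EM (finitely_generated I); last by right.
by left; apply: (directed_union_fg_principal D_gcd D_mono D_union).
Qed.
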